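(* Let $2\le k<n$ be integers and let $f_1,\dots,f_n\in\mathbb{R}^r$ satisfy $w_{ij}:=f_i^\top f_j\ge0$ for all $i\ne j$. The Greedy Feature-Balancing Algorithm is a $\left(1-\frac1k\right)$-approximation algorithm for Max-$k$-Cut: on input $f_1,\dots,f_n$ and $k$, it returns a partition $(A_1,\dots,A_k)$ of $[n]$ with $$\operatorname{Cut}(A_1,\dots,A_k)\ \ge\ \left(1-\frac1k\right)\operatorname{OPT}.$$
   Context: $[n]=\{1,\dots,n\}$ and $\|\cdot\|$ is the Euclidean norm. For a partition $(A_1,\dots,A_k)$ of $[n]$ into $k$ disjoint (possibly empty) parts, $\operatorname{Cut}(A_1,\dots,A_k)=\sum_{\ell<m}\sum_{i\in A_\ell,\,j\in A_m}w_{ij}$; Max-$k$-Cut asks to maximize this, and $\operatorname{OPT}$ is the maximum value. Greedy Feature-Balancing Algorithm (input: $f_1,\dots,f_n\in\mathbb{R}^r$ with $f_i^\top f_j\ge0$ for $i\neq j$, and $k$). Choose an ordering $(v_1,\dots,v_n)$ of $[n]$ with $\|f_{v_1}\|\ge\|f_{v_2}\|\ge\cdots\ge\|f_{v_n}\|$ (ties broken arbitrarily). Start with $A_1=\cdots=A_k=\emptyset$ and $s_1=\cdots=s_k=0\in\mathbb{R}^r$. For $t=1,\dots,n$: let $v=v_t$; choose $\ell^\star\in\arg\min_{\ell\in[k]}f_v^\top s_\ell$ (ties broken arbitrarily); replace $A_{\ell^\star}$ by $A_{\ell^\star}\cup\{v\}$ and $s_{\ell^\star}$ by $s_{\ell^\star}+f_v$.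 Return $(A_1,\dots,A_k)$. *)

(* Defs.v *)
From HB Require Import structures.
From mathcomp Require Import all_boot all_order all_algebra.
From mathcomp Require Import reals.

Set Implicit Arguments.
Unset Strict Implicit.
Unset Printing Implicit Defensive.

Import Order.TTheory GRing.Theory Num.Theory.
Local Open Scope ring_scope.

Definition dot (R : realType) (r : nat) (u v : 'cV[R]_r) : R :=
  (u^T *m v) ord0 ord0.

Definition enorm (R : realType) (r : nat) (u : 'cV[R]_r) : R :=
  Num.sqrt (dot u u).

Definition gram (R : realType) (n r : nat) (f : 'I_n -> 'cV[R]_r)
    (i j : 'I_n) : R :=
  dot (f i) (f j).

(* Parts are labelled by 'I_k and may be empty; finset's [partition] excludes
   empty blocks and does not fix their number. *)
Definition parts (n k : nat) := {ffun 'I_k -> {set 'I_n}}.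

Definition kpartition (n k : nat) (A : parts n k) : bool :=
  [forall l, forall m, (l != m) ==> [disjoint A l & A m]]
  && (\bigcup_l A l == [set: 'I_n]).

Definition cut (R : realType) (n k : nat) (w : 'I_n -> 'I_n -> R)
    (A : parts n k) : R :=
  \sum_(l < k) \sum_(m < k | (l < m)%N)
    \sum_(i in A l) \sum_(j in A m) w i j.

(* For 0 < k this is the maximum for weights of any sign: the initial value 0
   is the cut value of the partition with a single nonempty part. *)
Definition opt (R : realType) (n : nat) (w : 'I_n -> 'I_n -> R) (k : nat) : R :=
  \big[Num.max/0]_(A : parts n k | kpartition A) cut w A.

Record state (R : realType) (n r k : nat) := State {
  part : parts n k;
  psum : {ffun 'I_k -> 'cV[R]_r}
}.

Definition init_state (R : realType) (n r k : nat) : state R n r k :=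
  State [ffun=> set0] [ffun=> 0].

Definition assign (R : realType) (n r k : nat) (f : 'I_n -> 'cV[R]_r)
    (v : 'I_n) (l : 'I_k) (S : state R n r k) : state R n r k :=
  State [ffun m => if m == l then part S m :|: [set v] else part S m]
        [ffun m => if m == l then psum S m + f v else psum S m].

Definition greedy_choice (R : realType) (n r k : nat) (f : 'I_n -> 'cV[R]_r)
    (v : 'I_n) (S : state R n r k) (l : 'I_k) : Prop :=
  forall m : 'I_k, dot (f v) (psum S l) <= dot (f v) (psum S m).

(* [greedy_run f s S S']: processing the vertices of s in order can lead from S
   to S'. It is a relation because each tie in the arg min may be broken
   arbitrarily. *)
Inductive greedy_run (R : realType) (n r k : nat) (f : 'I_n -> 'cV[R]_r) :
    seq 'I_n -> state R n r k -> state R n r k -> Prop :=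
| greedy_nil S : greedy_run f [::] S S
| greedy_cons v s l S S' :
    greedy_choice f v S l ->
    greedy_run f s (assign f v l S) S' ->
    greedy_run f (v :: s) S S'.

Definition greedy_order (R : realType) (n r : nat) (f : 'I_n -> 'cV[R]_r)
    (s : seq 'I_n) : bool :=
  perm_eq s (enum 'I_n) && sorted (fun i j => enorm (f j) <= enorm (f i)) s.

(* A is a possible return value, for some way of breaking all ties. *)
Definition greedy_returns (R : realType) (n r k : nat) (f : 'I_n -> 'cV[R]_r)
    (A : parts n k) : Prop :=
  exists (s : seq 'I_n) (S : state R n r k),
    [/\ greedy_order f s, greedy_run f s (init_state R n r k) S & part S = A].

(* Main.v *)
(**
   For weights with zero diagonal, twice the cut of a partition is the total
   weight over ordered pairs minus the weight inside the parts.  Adding v to the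
   part minimising its weight to v increases k times the inner weight by at most
   the increase of the total weight, since a minimum is at most an average.
   Hence the inner weight stays below 1/k of the total weight, which itself
   bounds twice the optimum.  The order of the vertices plays no role.
*)
Require Import Defs.
From HB Require Import structures.
From mathcomp Require Import all_boot all_order all_algebra.
From mathcomp Require Import reals.
From mathcomp Require Import lra.
Set Implicit Arguments.
Unset Strict Implicit.
Unset Printing Implicit Defensive.

Import Order.TTheory GRing.Theory Num.Theory.
Local Open Scope ring_scope.

(** Cuts never see the diagonal, but [inner] would count the squared norms [gram f i i], and the
    inequality [balanced_inner] would not survive adding a vertex. *)
Definition offdiag {R : realType} {n : nat} (w : 'I_n -> 'I_n -> R)
    (i j : 'I_n) : R :=
  if i == j then 0 else w i j.

Definition inner {R : realType} {n : nat} (w : 'I_n -> 'I_n -> R)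
    (B : {set 'I_n}) : R :=
  \sum_(i in B) \sum_(j in B) w i j.

Definition disjoint_parts {n k : nat} (A : parts n k) : Prop :=
  forall l m, l != m -> [disjoint A l & A m].

Lemma kpartitionP {n k : nat} (A : parts n k) :
  reflect (disjoint_parts A /\ \bigcup_l A l = [set: 'I_n]) (kpartition A).
Proof.
apply: (iffP andP) => [[/forallP dA /eqP UA]|[dA UA]].
  by split=> // l m; apply/implyP; move/forallP: (dA l); apply.
split; last exact/eqP.
by apply/forallP => l; apply/forallP => m; apply/implyP; apply: dA.
Qed.

Lemma gramC (R : realType) (n r : nat) (f : 'I_n -> 'cV[R]_r) (i j : 'I_n) :
  gram f i j = gram f j i.
Proof.
by rewrite /gram /dot !mxE; apply: eq_bigr => a _; rewrite !mxE mulrC.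
Qed.

Lemma dot_sumr (R : realType) (n r : nat) (u : 'cV[R]_r) (f : 'I_n -> 'cV[R]_r)
    (B : {set 'I_n}) :
  dot u (\sum_(i in B) f i) = \sum_(i in B) dot u (f i).
Proof. by rewrite /dot mulmx_sumr summxE. Qed.

Lemma offdiagC (R : realType) (n : nat) (w : 'I_n -> 'I_n -> R) :
  (forall i j, w i j = w j i) -> forall i j, offdiag w i j = offdiag w j i.
Proof. by move=> wC i j; rewrite /offdiag eq_sym wC. Qed.

Lemma cut_offdiag (R : realType) (n k : nat) (w : 'I_n -> 'I_n -> R)
    (A : parts n k) :
  disjoint_parts A -> cut (offdiag w) A = cut w A.
Proof.
move=> dA; apply: eq_bigr => l _; apply: eq_bigr => m ltlm.
apply: eq_bigr => i Al_i; apply: eq_bigr => j Am_j.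
rewrite /offdiag; case: eqP => // eij.
have /dA/disjointFr/(_ Al_i) : l != m by rewrite neq_ltn ltlm.
by rewrite eij Am_j.
Qed.

Lemma inner_setU1 (R : realType) (n : nat) (w : 'I_n -> 'I_n -> R)
    (v : 'I_n) (B : {set 'I_n}) :
  (forall i j, w i j = w j i) -> w v v = 0 -> v \notin B ->
  inner w (v |: B) = inner w B + (\sum_(j in B) w v j) *+ 2.
Proof.
move=> wC wvv vB; rewrite /inner big_setU1 //= big_setU1 //= wvv add0r.
under [X in _ + X]eq_bigr => i _ do rewrite big_setU1 //= wC.
by rewrite big_split /= mulr2n addrC -addrA addrCA addrA.
Qed.

Lemma inner_ge0 (R : realType) (n : nat) (w : 'I_n -> 'I_n -> R)
    (B : {set 'I_n}) :
  (forall i j, 0 <= w i j) -> 0 <= inner w B.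
Proof. by move=> w0; do 2!apply: sumr_ge0 => ? _. Qed.

(** Split the double sum over the union into blocks [C l m]. The blocks with l < m add up to the
    cut, those with m < l do so again by symmetry, and the blocks with l = m are the inner
    weights. *)
Lemma cut_inner (R : realType) (n k : nat) (w : 'I_n -> 'I_n -> R)
    (A : parts n k) :
  (forall i j, w i j = w j i) -> disjoint_parts A ->
  inner w (\bigcup_l A l) = cut w A *+ 2 + \sum_l inner w (A l).
Proof.
move=> wC dA; pose C l m := \sum_(i in A l) \sum_(j in A m) w i j.
have CC l m : C l m = C m l.
  rewrite /C exchange_big; apply: eq_bigr => i _.
  by apply: eq_bigr => j _; rewrite wC.
have -> : inner w (\bigcup_l A l) = \sum_l \sum_m C l m.
  rewrite /inner partition_disjoint_bigcup //=; apply: eq_bigr => l _.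
  rewrite /C [RHS]exchange_big /=; apply: eq_bigr => i _.
  by rewrite partition_disjoint_bigcup.
have gtE : \sum_(l < k) \sum_(m < k | (m < l)%N) C l m = cut w A.
  rewrite (exchange_big_dep xpredT) //=; apply: eq_bigr => l _.
  by apply: eq_bigr => m _; apply: CC.
rewrite mulr2n -{2}gtE /cut -!big_split /=; apply: eq_bigr => l _.
rewrite (bigID (fun m : 'I_k => (l < m)%N)) /= -addrA; congr (_ + _).
rewrite (bigD1 l) ?ltnn //= addrC; congr (_ + _).
by apply: eq_bigl => m; rewrite -leqNgt ltn_neqAle andbC.
Qed.

(** Loop invariant, with [U] the set of vertices processed so far. *)
Record balanced {R : realType} {n r k : nat} (f : 'I_n -> 'cV[R]_r)
    (U : {set 'I_n}) (S : state R n r k) : Prop := Balanced {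
  balanced_disjoint : disjoint_parts (part S);
  balanced_cover : \bigcup_l part S l = U;
  balanced_psum : forall l, psum S l = \sum_(i in part S l) f i;
  balanced_inner : k%:R * (\sum_l inner (offdiag (gram f)) (part S l))
                   <= inner (offdiag (gram f)) U
}.

Lemma balanced_init (R : realType) (n r k : nat) (f : 'I_n -> 'cV[R]_r) :
  balanced f set0 (init_state R n r k).
Proof.
split=> /= [l m _|||]; first by rewrite !ffunE -setI_eq0 setI0.
- by apply: big1 => l _; rewrite ffunE.
- by move=> l; rewrite !ffunE big_set0.
rewrite /inner big_set0 big1 ?mulr0 // => l _.
by rewrite ffunE big_set0.
Qed.

Lemma balanced_assign (R : realType) (n r k : nat) (f : 'I_n -> 'cV[R]_r)
    (U : {set 'I_n}) (v : 'I_n) (l : 'I_k) (S : state R n r k) :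
  balanced f U S -> v \notin U -> greedy_choice f v S l ->
  balanced f (v |: U) (assign f v l S).
Proof.
move=> [dS cS pS bS] vU gl.
have vS m : v \notin part S m.
  by apply: contra vU => vSm; rewrite -cS; apply/bigcupP; exists m.
have wC := offdiagC (gramC f).
have wvv : offdiag (gram f) v v = 0 by rewrite /offdiag eqxx.
(* By linearity, the quantity minimised by the greedy choice is the weight from [v] to a part; as
   [v] lies in no part, the zeroed diagonal is not met. *)
have degE m : \sum_(j in part S m) offdiag (gram f) v j = dot (f v) (psum S m).
  rewrite pS dot_sumr; apply: eq_bigr => j Smj; rewrite /offdiag.
  by case: eqP => // evj; move: (vS m); rewrite evj Smj.
split=> /=.
- have dv m m' : m != m' -> part S m :&: part S m' = set0.
    by move=> /dS; rewrite -setI_eq0 => /eqP.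
  move=> m m' mm'; rewrite !ffunE -setI_eq0.
  have v0 m1 : [set v] :&: part S m1 = set0.
    by apply/eqP; rewrite setI_eq0 disjoints1.
  case: (eqVneq m l) mm' => [->|_] mm'.
    by rewrite [m' == l]eq_sym (negbTE mm') setIUl v0 setU0 dv.
  case: (m' =P l) => _; last by rewrite dv.
  by rewrite setIUr [_ :&: [set v]]setIC v0 setU0 dv.
- rewrite -cS (bigD1 l) //= (bigD1 (P := xpredT) l) //= ffunE eqxx setUA.
  rewrite [_ :|: [set v]]setUC; congr (_ :|: _).
  by apply: eq_bigr => m /negbTE ml; rewrite ffunE ml.
- move=> m; rewrite !ffunE; case: eqP => // _.
  by rewrite setUC big_setU1 //= addrC pS.
have -> : \sum_m inner (offdiag (gram f)) ([ffun m => if m == l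
      then part S m :|: [set v] else part S m] m)
    = \sum_m inner (offdiag (gram f)) (part S m) + dot (f v) (psum S l) *+ 2.
  rewrite (bigD1 l) //= [in RHS](bigD1 l) //= ffunE eqxx setUC.
  rewrite inner_setU1 // degE addrAC; congr (_ + _ + _).
  by apply: eq_bigr => m /negbTE ml; rewrite ffunE ml.
(* After cancelling the invariant for [S] and the common factor 2, it remains to compare k times the
   weight from [v] to part [l] with the weight from [v] to all of [U], split over the parts. *)
rewrite inner_setU1 // mulrDr lerD // mulrnAr lerMn2r /= -cS.
rewrite partition_disjoint_bigcup //= (eq_bigr _ (fun m _ => degE m)).
rewrite mulr_natl -[k in _ *+ k]card_ord -sumr_const.
by apply: ler_sum => m _; apply: gl.
Qed.

(** [U] is arbitrary because the induction on the run moves the head of [s] into it. *)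
Lemma balanced_run (R : realType) (n r k : nat) (f : 'I_n -> 'cV[R]_r)
    (s : seq 'I_n) (S S' : state R n r k) (U : {set 'I_n}) :
  greedy_run f s S S' -> balanced f U S -> uniq s ->
  {in s, forall v, v \notin U} -> balanced f ([set:: s] :|: U) S'.
Proof.
move=> run; elim: run U => {s S S'} [S|v s l S S' gl _ IH] U bS /=.
  by rewrite set_nil set0U.
case/andP=> vs us sU; rewrite set_cons setUAC setUC.
have vU : v \notin U by apply: sU; rewrite mem_head.
apply: IH => //; first exact: balanced_assign.
move=> u su; rewrite !inE negb_or sU ?inE ?su ?orbT // andbT.
by apply: contraNneq vs => <-.
Qed.

(** With [greedy_order_exists], this makes the guarantee non-vacuous; [0 < k] provides a candidate
    for the arg min. *)
Lemma greedy_run_exists (R : realType) (n r k : nat) (f : 'I_n -> 'cV[R]_r)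
    (s : seq 'I_n) (S : state R n r k) :
  (0 < k)%N -> exists S', greedy_run f s S S'.
Proof.
move=> k0; elim: s S => [|v s IH] S; first by exists S; constructor.
have [l _ lmin] := Order.TotalTheory.arg_minP (i0 := Ordinal k0) (P := xpredT)
  (fun l => dot (f v) (psum S l)) isT.
have [S' run] := IH (assign f v l S).
by exists S'; apply: greedy_cons run => m; apply: lmin.
Qed.

Lemma greedy_order_exists (R : realType) (n r : nat) (f : 'I_n -> 'cV[R]_r) :
  exists s, greedy_order f s.
Proof.
exists (sort (fun i j => enorm (f j) <= enorm (f i)) (enum 'I_n)).
by rewrite /greedy_order perm_sort perm_refl sort_sorted // => i j; exact: le_total.
Qed.

Lemma opt_le_inner (R : realType) (n k : nat) (w : 'I_n -> 'I_n -> R) :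
  (forall i j, w i j = w j i) -> (forall i j, i != j -> 0 <= w i j) ->
  opt w k *+ 2 <= inner (offdiag w) [set: 'I_n].
Proof.
move=> wC w0.
have o0 i j : 0 <= offdiag w i j by rewrite /offdiag; case: eqVneq => // /w0.
(* The initial value 0 of the maximum must also obey the bound, hence the first subgoal. *)
rewrite -mulr_natr -ler_pdivlMr ?ltr0n //; apply: bigmax_le.
  by rewrite divr_ge0 ?ler0n ?inner_ge0.
move=> A /kpartitionP[dA <-]; rewrite ler_pdivlMr ?ltr0n // mulr_natr.
rewrite cut_inner //; last exact: offdiagC.
by rewrite cut_offdiag // lerDl sumr_ge0 // => l _; apply: inner_ge0.
Qed.

Theorem proposition11 (R : realType) (n k r : nat)
  (hk : (2 <= k)%N) (hkn : (k < n)%N) (f : 'I_n -> 'cV[R]_r)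
  (hw : forall i j : 'I_n, i != j -> 0 <= gram f i j) :
  (exists A : parts n k, greedy_returns f A) /\
  (forall A : parts n k, greedy_returns f A ->
     kpartition A /\
     (1 - k%:R^-1) * opt (gram f) k <= cut (gram f) A).
Proof.
have k0 : (0 < k)%N by apply: ltn_trans hk.
split.
  have [s os] := greedy_order_exists f.
  have [S run] := greedy_run_exists f s (init_state R n r k) k0.
  by exists (part S), s, S.
move=> _ [s [S [/andP[ps _] run <-]]].
have := balanced_run run (balanced_init k f).
rewrite (perm_uniq ps) enum_uniq setU0.
have -> : [set:: s] = [set: 'I_n].
  by apply/setP => i; rewrite !inE (perm_mem ps) mem_enum.
case=> // [v _|dS cS _ bS]; first by rewrite inE.
split; first exact/kpartitionP.
have := cut_inner (offdiagC (gramC f)) dS.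
rewrite cS cut_offdiag // => totE.
have := opt_le_inner k (gramC f) hw.
rewrite -ler_pdivlMl ?ltr0n // in bS.
have kV : k%:R^-1 <= 1 :> R by rewrite invf_le1 ?ltr0n // ler1n.
(* With T the total and I the inner weight, 2 cut = T - I and I <= T/k give 2 cut >= (1 - 1/k) T.
   Scaling 2 opt <= T by 1 - 1/k >= 0 leaves a linear problem. *)
move=> /(ler_wpM2l (_ : 0 <= 1 - k%:R^-1)); rewrite subr_ge0 => /(_ kV).
lra.
Qed.
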